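(* Let $n\ge2$, $\mathbf{a}\in\mathbb{C}^n$, $\beta>0$ and $f(\mathbf{z})=\frac12|\mathbf{a}^*\mathbf{z}|^2+\frac{\beta}{2}\|\mathbf{z}\|_4^4$ on $\mathbb{CS}^{n-1}$. There exists a local minimizer $\mathbf{z}$ of $f$ on $\mathbb{CS}^{n-1}$ with $\mathbf{a}^*\mathbf{z}=0$ if and only if either $\|\mathbf{a}\|_\infty\le\frac12\|\mathbf{a}\|_1$, or $\mathbf{a}$ has exactly one nonzero component and $\|\mathbf{a}\|_2^2\ge 2\beta/(n-1)$. Further, if $\mathbf{a}$ satisfies one of these conditions, then the local minimizers $\mathbf{z}$ with $\mathbf{a}^*\mathbf{z}=0$ are exactly the global minimizers of $f$ on $\mathbb{CS}^{n-1}$.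
   Context: $\mathbb{CS}^{n-1}=\{\mathbf{z}\in\mathbb{C}^n:\|\mathbf{z}\|_2=1\}$; $\|\mathbf{z}\|_4^4=\sum_k|z_k|^4$. *)

(* Defs.v *)
From HB Require Import structures.
From mathcomp Require Import all_boot all_order all_algebra.
From mathcomp Require Import reals.
From mathcomp.real_closed Require Import complex.
Set Implicit Arguments. Unset Strict Implicit. Unset Printing Implicit Defensive.
Import Order.TTheory GRing.Theory Num.Theory.
Local Open Scope ring_scope.
Local Open Scope complex_scope.

Definition cabs2 (R : realType) (c : R[i]) : R := (@complex.Re R c) ^+ 2 + (@complex.Im R c) ^+ 2.

Definition cabs (R : realType) (c : R[i]) : R := Num.sqrt (cabs2 c).

Definition cinner (R : realType) (n : nat) (a z : 'I_n -> R[i]) : R[i] :=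
  \sum_(k < n) (a k)^* * z k.

Definition norm2sq (R : realType) (n : nat) (z : 'I_n -> R[i]) : R :=
  \sum_(k < n) cabs2 (z k).

Definition norm4pow4 (R : realType) (n : nat) (z : 'I_n -> R[i]) : R :=
  \sum_(k < n) (cabs2 (z k)) ^+ 2.

Definition norm1 (R : realType) (n : nat) (a : 'I_n -> R[i]) : R :=
  \sum_(k < n) cabs (a k).
Definition norminf (R : realType) (n : nat) (a : 'I_n -> R[i]) : R :=
  \big[Num.max/0]_(k < n) cabs (a k).

Definition on_sphere (R : realType) (n : nat) (z : 'I_n -> R[i]) : Prop :=
  norm2sq z = 1.

Definition fobj (R : realType) (n : nat) (a : 'I_n -> R[i]) (beta : R)
  (z : 'I_n -> R[i]) : R :=
  2^-1 * cabs2 (cinner a z) + beta / 2 * norm4pow4 z.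

Definition local_min_sphere (R : realType) (n : nat) (f : ('I_n -> R[i]) -> R)
  (z : 'I_n -> R[i]) : Prop :=
  on_sphere z /\
  exists2 eps : R, 0 < eps &
    forall w : 'I_n -> R[i], on_sphere w ->
      norm2sq (fun k => w k - z k) < eps ^+ 2 -> f z <= f w.

Definition global_min_sphere (R : realType) (n : nat) (f : ('I_n -> R[i]) -> R)
  (z : 'I_n -> R[i]) : Prop :=
  on_sphere z /\ forall w : 'I_n -> R[i], on_sphere w -> f z <= f w.

(* Main.v *)
Require Import Defs.
From mathcomp Require Import all_boot all_order all_algebra.
From mathcomp Require Import reals.
From mathcomp.real_closed Require Import complex polyrcf.
From mathcomp Require Import ring lra.
Import Order.TTheory GRing.Theory Num.Theory.
Local Open Scope complex_scope.
Local Open Scope ring_scope.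

Set Implicit Arguments.
Unset Strict Implicit.
Unset Printing Implicit Defensive.

(** Let [z] be a local minimizer with [a^* z = 0].  On the sphere the objective [f]
    agrees with a homogeneous quartic [F], so along a line [z + t v] with [v]
    tangent the polynomial [F (z + t v) - f z * |z + t v|^4] has a local minimum at
    [t = 0].  Rescaling a single coordinate shows that [z] is flat:
    [|z_k|^2 = 1 / #|S|] on its support [S].  Rotating phases and moving mass off
    [S] then gives
      [2 beta / #|S| * \sum_(k \notin S) |w_k|^2 <= |a^* w|^2]  for every [w].
    Conversely, this inequality and the convexity bound on [\sum_(k in S) |w_k|^4]
    make any flat [z] on [S] orthogonal to [a] a global minimizer.  As the form
    [|a^* w|^2] has rank at most one, the inequality forces [S] to be everything or
    to miss only the index [j] that carries [a].  In the first case the numbers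
    [conj a_k z_k] close up to a polygon with sides proportional to [|a_k|]. *)

Lemma setTPn (T : finType) (A : {set T}) :
  reflect (exists x, x \notin A) (A != setT).
Proof.
rewrite -subTset; apply: (iffP subsetPn) => [[x _ xNA]|[x xNA]]; first by exists x.
by exists x; rewrite ?inE.
Qed.

Lemma natr_card_gt0 (R : numDomainType) (T : finType) (A : {set T}) :
  A != set0 -> 0 < #|A|%:R :> R.
Proof. by rewrite -card_gt0 ltr0n. Qed.

Lemma sum_sqr_ge_tangent (R : realDomainType) (I : finType) (A : {set I})
    (x : I -> R) (m : R) :
  2 * m * (\sum_(i in A) x i) - #|A|%:R * m ^+ 2 <= \sum_(i in A) x i ^+ 2.
Proof.
rewrite -subr_ge0 [#|A|%:R * _]mulr_natl -sumr_const mulr_sumr -!sumrB.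
apply: sumr_ge0 => i _.
have -> : x i ^+ 2 - (2 * m * x i - m ^+ 2) = (x i - m) ^+ 2 by ring.
exact: sqr_ge0.
Qed.

Lemma ler_norm_sum_eq0 (R : numDomainType) (V : normedZmodType R) (I : finType)
    (x : I -> V) (k : I) :
  \sum_i x i = 0 -> 2 * `|x k| <= \sum_i `|x i|.
Proof.
rewrite (bigD1 k) //= => /eqP; rewrite addr_eq0 => /eqP xkE.
rewrite [leRHS](bigD1 k) //=.
by rewrite mulr_natl mulr2n lerD2l xkE normrN ler_norm_sum.
Qed.

Lemma polar_form (F : numFieldType) (c : F) :
  exists2 u, `|u| = 1 & c = `|c| * u.
Proof.
have [->|c_neq0] := eqVneq c 0; first by exists 1; rewrite ?normr1 // normr0 mul0r.
exists (c / `|c|); last by rewrite mulrC divfK ?normr_eq0.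
by rewrite normf_div normr_id divff ?normr_eq0.
Qed.

Section PolynomialMinimum.
Variable R : rcfType.
Implicit Types (p : {poly R}) (d t : R).

Lemma horner0_ge0 p d :
  0 < d -> (forall t, 0 < t < d -> 0 <= p.[t]) -> 0 <= p.[0].
Proof.
move=> d_gt0 p_ge0; rewrite leNgt; apply/negP => p0_lt0.
have [|e e_gt0 p_near0] := @poly_cont _ 0 p (- p.[0]); first by rewrite oppr_gt0.
pose t := Num.min d e / 2.
have [t_gt0 t_lt_d t_lt_e] : [/\ 0 < t, t < d & t < e].
  by rewrite /t; split; case: (ltP d e) => ?; lra.
have := p_near0 t; rewrite subr0 gtr0_norm // => /(_ t_lt_e).
have := p_ge0 t; rewrite t_gt0 t_lt_d => /(_ isT).
by move=> pt_ge0; rewrite ltr_norml => /andP[_]; lra.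
Qed.

Lemma horner_drop1 p t : p.[t] = p.[0] + (drop_poly 1 p).[t] * t.
Proof.
rewrite -{1}(poly_take_drop 1 p) hornerD hornerM expr1 hornerX; congr (_ + _).
by rewrite (size1_polyC (size_take_poly 1 p)) hornerC coef_take_poly horner_coef0.
Qed.

Lemma poly_local_min0 p d : 0 < d -> (forall t, `|t| < d -> p.[0] <= p.[t]) ->
  p`_1 = 0 /\ 0 <= p`_2.
Proof.
move=> d_gt0 p_min; pose q := drop_poly 1 p.
have q_ge0 t : `|t| < d -> 0 <= q.[t] * t.
  by move=> /p_min; rewrite (horner_drop1 p t) lerDl.
have q0 : q.[0] = 0.
  apply/eqP; rewrite eq_le; apply/andP; split.
    have -> : q.[0] = - (- q \Po - 'X).[0] by rewrite horner_comp !hornerE oppr0 opprK.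
    rewrite oppr_le0; apply: (@horner0_ge0 _ d) => // t /andP[t_gt0 t_lt].
    rewrite horner_comp !hornerE -(pmulr_lge0 _ t_gt0) mulNr -mulrN.
    by apply: q_ge0; rewrite normrN gtr0_norm.
  apply: (@horner0_ge0 _ d) => // t /andP[t_gt0 t_lt].
  by rewrite -(pmulr_lge0 _ t_gt0) q_ge0 // gtr0_norm.
split; first by have := q0; rewrite horner_coef0 coef_drop_poly.
have -> : p`_2 = (drop_poly 1 q).[0] by rewrite horner_coef0 !coef_drop_poly.
apply: (@horner0_ge0 _ d) => // t /andP[t_gt0 t_lt].
have qtE : q.[t] = (drop_poly 1 q).[t] * t by rewrite horner_drop1 q0 add0r.
by rewrite -(pmulr_lge0 _ t_gt0) -qtE -(pmulr_lge0 _ t_gt0) q_ge0 // gtr0_norm.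
Qed.

Lemma sqrM_lt_near0 (m e : R) :
  0 < e -> exists2 d, 0 < d & forall t, `|t| < d -> t ^+ 2 * m < e.
Proof.
move=> e_gt0; have [d d_gt0 near0] := poly_cont 0 (m *: 'X^2) e_gt0.
exists d => // t t_lt; apply: le_lt_trans (ler_norm _) _.
have := near0 t; rewrite subr0 !hornerZ !hornerXn expr0n mulr0 subr0 mulrC.
exact.
Qed.

End PolynomialMinimum.

Section Polygons.
Variable R : rcfType.
Implicit Types x y r : R.

Lemma triangle_exists x y r : 0 <= x -> 0 <= y -> 0 <= r ->
    r <= x + y -> x <= r + y -> y <= r + x ->
  exists u v : R[i], [/\ `|u| = 1, `|v| = 1 & x%:C * u + y%:C * v = r%:C].
Proof.
move=> x_ge0 y_ge0 r_ge0 r_le x_le y_le.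
suff [c [d [normc normd cdE]]] : exists c d : R[i],
    [/\ `|c| = x%:C, `|d| = y%:C & c + d = r%:C].
  have [u normu cE] := polar_form c; have [v normv dE] := polar_form d.
  by exists u, v; split=> //; rewrite -normc -normd -cE -dE.
have [r_eq0|r_neq0] := eqVneq r 0.
  exists x%:C, (- x%:C); rewrite normrN subrr r_eq0 normc_def /= expr0n addr0.
  by rewrite sqrtr_sqr ger0_norm //; split=> //; congr _%:C; lra.
have r_gt0 : 0 < r by rewrite lt_def r_neq0.
pose p := (r ^+ 2 + x ^+ 2 - y ^+ 2) / (2 * r).
have pE : 2 * r * p = r ^+ 2 + x ^+ 2 - y ^+ 2 by rewrite /p; field.
have p_bound : p ^+ 2 <= x ^+ 2.
  have p_le : p <= x by rewrite /p ler_pdivrMr ?mulr_gt0 //; nra.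
  have p_ge : - x <= p by rewrite /p ler_pdivlMr ?mulr_gt0 //; nra.
  nra.
pose q := Num.sqrt (x ^+ 2 - p ^+ 2).
have qE : q ^+ 2 = x ^+ 2 - p ^+ 2 by rewrite sqr_sqrtr // subr_ge0.
exists (p +i* q), ((r - p) -i* q); split.
- by rewrite normc_def /= qE subrKC sqrtr_sqr ger0_norm.
- rewrite normc_def /= sqrrN qE.
  have -> : (r - p) ^+ 2 + (x ^+ 2 - p ^+ 2) = y ^+ 2 by lra.
  by rewrite sqrtr_sqr ger0_norm.
- by apply/eqP; rewrite eq_complex /= subrKC subrr !eqxx.
Qed.

(* In the inductive step the tail must close up with some magnitude [tail_rho]
   subject to several lower bounds and the upper bounds [rho + r x] and [S];
   taking the smaller upper bound reduces everything to pairwise comparisons. *)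
Lemma polygon_exists (I : eqType) (s : seq I) (r : I -> R) (rho : R) :
    uniq s -> (forall i, 0 <= r i) -> 0 <= rho -> rho <= \sum_(i <- s) r i ->
    {in s, forall i, 2 * r i <= rho + \sum_(i <- s) r i} ->
  exists2 u : I -> R[i], forall i, `|u i| = 1 &
    \sum_(i <- s) (r i)%:C * u i = rho%:C.
Proof.
move=> uniq_s r_ge0; elim: s uniq_s rho => [_|x s IHs /= /andP[xNs uniq_s]] rho rho_ge0.
  rewrite big_nil => rho_le0 _; exists (fun=> 1) => [_|]; first exact: normr1.
  by rewrite big_nil; congr _%:C; apply/eqP; rewrite eq_le rho_ge0.
rewrite big_cons; set S := \sum_(i <- s) r i => rho_le r_le.
have rx_le : 2 * r x <= rho + (r x + S) := r_le x (mem_head _ _).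
have rx_ge0 := r_ge0 x.
have S_ge0 : 0 <= S by apply: sumr_ge0.
pose tail_rho := Num.min (rho + r x) S.
have [tail_le_rho tail_leS] : tail_rho <= rho + r x /\ tail_rho <= S.
  by rewrite !ge_min !lexx orbT.
have tail_ge t : t <= rho + r x -> t <= S -> t <= tail_rho.
  by move=> t_le_rho t_leS; rewrite le_min t_le_rho.
have [|||u normu uE] := IHs uniq_s tail_rho => //.
- by apply: tail_ge; lra.
- move=> i si; rewrite -/S -lerBlDr.
  have ri_leS : r i <= S by rewrite /S (big_rem i) //= lerDl sumr_ge0.
  have := r_le i; rewrite inE si orbT => /(_ isT) ri_le.
  by apply: tail_ge; lra.
have [||||||v [w [normv normw vwE]]] := @triangle_exists (r x) tail_rho rho => //.
- by apply: tail_ge; lra.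
- by rewrite -lerBlDl; apply: tail_ge; lra.
- by rewrite -lerBlDl; apply: tail_ge; lra.
exists (fun i => if i == x then v else w * u i) => [i|].
  by case: ifP => // _; rewrite normrM normw normu mulr1.
rewrite big_cons eqxx -vwE -uE mulr_suml; congr (_ + _).
apply: eq_big_seq => i si; case: eqP => [ix|_]; first by rewrite ix (negPf xNs) in si.
by rewrite mulrAC mulrA.
Qed.

End Polygons.

Section RealInnerProduct.
Variable R : realType.
Implicit Types (c d : R[i]) (x : R).

Definition rdot c d : R :=
  complex.Re c * complex.Re d + complex.Im c * complex.Im d.

Lemma cabsE c : (cabs c)%:C = `|c|.
Proof. by rewrite normc_def. Qed.

Lemma cabs2E c : (cabs2 c)%:C = `|c| ^+ 2.
Proof. exact: add_Re2_Im2. Qed.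

Lemma cabs2_ge0 c : 0 <= cabs2 c.
Proof. by rewrite addr_ge0 ?sqr_ge0. Qed.

Lemma cabs_ge0 c : 0 <= cabs c.
Proof. exact: sqrtr_ge0. Qed.

Lemma cabs2_eq0 c : (cabs2 c == 0) = (c == 0).
Proof. by rewrite -(inj_eq (@complexI R)) cabs2E sqrf_eq0 normr_eq0. Qed.

Lemma cabs20 : cabs2 (0 : R[i]) = 0.
Proof. by apply/eqP; rewrite cabs2_eq0. Qed.

Lemma cabs2_le0 c : (cabs2 c <= 0) = (c == 0).
Proof. by rewrite le_eqVlt ltNge cabs2_ge0 orbF cabs2_eq0. Qed.

Lemma cabs2M c d : cabs2 (c * d) = cabs2 c * cabs2 d.
Proof. by case: c d => [x y] [u v]; rewrite /cabs2 /=; ring. Qed.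

Lemma cabs2_real x : cabs2 x%:C = x ^+ 2.
Proof. by rewrite /cabs2 /= expr0n addr0. Qed.

Lemma cabs2_conj c : cabs2 c^* = cabs2 c.
Proof. by apply: complexI; rewrite !cabs2E norm_conjC. Qed.

Lemma cabs2D c d : cabs2 (c + d) = cabs2 c + 2 * rdot c d + cabs2 d.
Proof. by case: c d => [x y] [u v]; rewrite /cabs2 /rdot /=; ring. Qed.

Lemma cabs2B c d : cabs2 (c - d) = cabs2 c - 2 * rdot d c + cabs2 d.
Proof. by case: c d => [x y] [u v]; rewrite /cabs2 /rdot /=; ring. Qed.

Lemma rdotZr x c d : rdot c (x%:C * d) = x * rdot c d.
Proof. by case: c d => [p q] [u v]; rewrite /rdot /=; ring. Qed.

Lemma rdotDr c d e : rdot c (d + e) = rdot c d + rdot c e.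
Proof. by case: c d e => [p q] [u v] [s t]; rewrite /rdot /=; ring. Qed.

Lemma rdotcc c : rdot c c = cabs2 c.
Proof. by rewrite /rdot -!expr2. Qed.

Lemma rdot0l c : rdot 0 c = 0.
Proof. by rewrite /rdot /= !mul0r addr0. Qed.

Lemma rdot0r c : rdot c 0 = 0.
Proof. by rewrite /rdot /= !mulr0 addr0. Qed.

Lemma rdot_mulir c : rdot c ('i * c) = 0.
Proof. by rewrite -complexiE; case: c => x y; rewrite /rdot /=; ring. Qed.

End RealInnerProduct.

Section ComplexVectors.
Variables (R : realType) (n : nat).
Implicit Types (a v w z : 'I_n -> R[i]) (t : R) (S : {set 'I_n}) (j k l : 'I_n).

Definition csupp z : {set 'I_n} := [set k | z k != 0].

Definition cscale t z k := t%:C * z k.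

Definition cline z v t k := z k + t%:C * v k.

Definition point_mass j (c : R[i]) k := if k == j then c else 0.

Definition balanced_pair a j l (x : R[i]) k :=
  point_mass l x k + point_mass j (- ((a l)^* * x / (a j)^*)) k.

Definition rinner z v : R := \sum_(k < n) rdot (z k) (v k).

Definition mass_off S w : R := \sum_(k | k \notin S) cabs2 (w k).

Lemma csuppPn z k : reflect (z k = 0) (k \notin csupp z).
Proof. by rewrite inE negbK; apply: eqP. Qed.

Lemma norm2sq_csupp z : norm2sq z = \sum_(k in csupp z) cabs2 (z k).
Proof.
rewrite /norm2sq (bigID [in csupp z]) /= [X in _ + X]big1 ?addr0 // => k /csuppPn ->.
exact: cabs20.
Qed.

Lemma cinner_csupp a z : cinner a z = \sum_(k in csupp a) (a k)^* * z k.
Proof.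
rewrite /cinner (bigID [in csupp a]) /= [X in _ + X]big1 ?addr0 // => k /csuppPn ->.
by rewrite rmorph0 mul0r.
Qed.

Lemma cinnerDr a v w : cinner a (fun k => v k + w k) = cinner a v + cinner a w.
Proof. by rewrite -big_split; apply: eq_bigr => k _; rewrite mulrDr. Qed.

Lemma cinner_cscale a z t : cinner a (cscale t z) = t%:C * cinner a z.
Proof. by rewrite mulr_sumr; apply: eq_bigr => k _; rewrite mulrCA. Qed.

Lemma cinner_cline a z v t : cinner a (cline z v t) = cinner a z + t%:C * cinner a v.
Proof. by rewrite cinnerDr cinner_cscale. Qed.

Lemma cinner_point_mass a j c : cinner a (point_mass j c) = (a j)^* * c.
Proof.
rewrite /cinner (bigD1 j) //= /point_mass eqxx big1 ?addr0 // => k /negPf ->.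
by rewrite mulr0.
Qed.

Lemma cinner_balanced_pair a j l x : a j != 0 -> cinner a (balanced_pair a j l x) = 0.
Proof.
move=> aj_neq0; rewrite cinnerDr !cinner_point_mass mulrN mulrCA divff ?conjC_eq0 //.
by rewrite mulr1 subrr.
Qed.

Lemma balanced_pairE a j l x k : l != j ->
  balanced_pair a j l x k = if k == l then x else
                            if k == j then - ((a l)^* * x / (a j)^*) else 0.
Proof.
rewrite /balanced_pair /point_mass => /negPf lNj.
by case: eqP => [->|_]; rewrite ?lNj ?addr0 ?add0r.
Qed.

Lemma balanced_pair_eq0 a j l x : l != j -> a j != 0 -> x != 0 ->
  (balanced_pair a j l x j == 0) = (a l == 0).
Proof.
move=> lNj /negPf aj_neq0 /negPf x_neq0.
rewrite balanced_pairE // [j == l]eq_sym (negPf lNj) eqxx.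
by rewrite oppr_eq0 !mulf_eq0 invr_eq0 !conjC_eq0 aj_neq0 x_neq0 !orbF.
Qed.

Lemma norm2sq_ge0 z : 0 <= norm2sq z.
Proof. by apply: sumr_ge0 => k _; apply: cabs2_ge0. Qed.

Lemma norm2sq_cscale z t : norm2sq (cscale t z) = t ^+ 2 * norm2sq z.
Proof. by rewrite mulr_sumr; apply: eq_bigr => k _; rewrite cabs2M cabs2_real. Qed.

Lemma norm4pow4_cscale z t : norm4pow4 (cscale t z) = t ^+ 4 * norm4pow4 z.
Proof.
rewrite mulr_sumr; apply: eq_bigr => k _.
by rewrite cabs2M cabs2_real exprMn -exprM.
Qed.

Lemma norm2sq_sub w z :
  norm2sq (fun k => w k - z k) = norm2sq w - 2 * rinner z w + norm2sq z.
Proof.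
rewrite /norm2sq /rinner mulr_sumr -sumrB -big_split /=.
by apply: eq_bigr => k _; rewrite cabs2B.
Qed.

Lemma rinner_cscale z w t : rinner z (cscale t w) = t * rinner z w.
Proof. by rewrite mulr_sumr; apply: eq_bigr => k _; rewrite rdotZr. Qed.

Lemma rinner_cline z v t : rinner z (cline z v t) = norm2sq z + t * rinner z v.
Proof.
rewrite mulr_sumr -big_split; apply: eq_bigr => k _.
by rewrite rdotDr rdotcc rdotZr.
Qed.

Lemma norm2sq_cline z v t :
  norm2sq (cline z v t) = norm2sq z + 2 * t * rinner z v + t ^+ 2 * norm2sq v.
Proof.
rewrite /norm2sq /rinner !mulr_sumr -!big_split; apply: eq_bigr => k _ /=.
by rewrite cabs2D rdotZr cabs2M cabs2_real mulrA.
Qed.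

Lemma norm4pow4_cline z v t :
  norm4pow4 (cline z v t) =
  norm4pow4 z + t * (4 * \sum_(k < n) cabs2 (z k) * rdot (z k) (v k))
  + t ^+ 2 * (\sum_(k < n) (4 * rdot (z k) (v k) ^+ 2
                            + 2 * cabs2 (z k) * cabs2 (v k)))
  + t ^+ 3 * (4 * \sum_(k < n) rdot (z k) (v k) * cabs2 (v k))
  + t ^+ 4 * norm4pow4 v.
Proof.
rewrite /norm4pow4 !mulr_sumr -!big_split; apply: eq_bigr => k _ /=.
by rewrite cabs2D rdotZr cabs2M cabs2_real; ring.
Qed.

Lemma mass_off_le0 S w k : mass_off S w <= 0 -> k \notin S -> w k = 0.
Proof.
move=> mass_le0 kNS; apply/eqP; rewrite -cabs2_le0; apply: le_trans mass_le0.
rewrite /mass_off (bigD1 k) //= lerDl.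
by apply: sumr_ge0 => l _; apply: cabs2_ge0.
Qed.

Lemma mass_off_point_mass S j c :
  j \notin S -> mass_off S (point_mass j c) = cabs2 c.
Proof.
move=> jNS; rewrite /mass_off (bigD1 j) //= /point_mass eqxx big1 ?addr0 //.
by move=> k /andP[_ /negPf ->]; apply: cabs20.
Qed.

Lemma mass_off_setT w : mass_off setT w = 0.
Proof. by rewrite /mass_off big_pred0 // => k; rewrite inE. Qed.

Lemma mass_off_setC1 j w : mass_off [set~ j] w = cabs2 (w j).
Proof. by rewrite /mass_off (big_pred1 j) // => k; rewrite !inE negbK. Qed.

Lemma norm2sq_mass_off S w :
  norm2sq w = \sum_(k in S) cabs2 (w k) + mass_off S w.
Proof. by rewrite /norm2sq (bigID [in S]). Qed.

End ComplexVectors.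

Section SphereMinima.
Variables (R : realType) (n : nat).
Implicit Types (f : ('I_n -> R[i]) -> R) (v w z : 'I_n -> R[i]) (t : R).

Lemma global_local_min f z : global_min_sphere f z -> local_min_sphere f z.
Proof. by move=> [z1 zmin]; split=> //; exists 1 => // w w1 _; apply: zmin. Qed.

Lemma sphere_retraction z v t : on_sphere z -> rinner z v = 0 ->
  exists s, [/\ s ^+ 2 * norm2sq (cline z v t) = 1,
    on_sphere (cscale s (cline z v t)) &
    norm2sq (fun k => cscale s (cline z v t) k - z k) <= 2 * (t ^+ 2 * norm2sq v)].
Proof.
move=> z1 zv0; set X := t ^+ 2 * norm2sq v.
have X_ge0 : 0 <= X by rewrite mulr_ge0 ?sqr_ge0 ?norm2sq_ge0.
have normE : norm2sq (cline z v t) = 1 + X by rewrite norm2sq_cline z1 zv0 mulr0 addr0.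
pose s := (Num.sqrt (1 + X))^-1.
have s_gt0 : 0 < s by rewrite invr_gt0 sqrtr_gt0 ltr_pwDl.
have sE : s ^+ 2 * (1 + X) = 1.
  by rewrite exprVn sqr_sqrtr ?addr_ge0 // mulVf // gt_eqF // ltr_pwDl.
have sw1 : on_sphere (cscale s (cline z v t)).
  by rewrite /on_sphere norm2sq_cscale normE.
exists s; split; rewrite ?normE //.
rewrite norm2sq_sub sw1 z1 rinner_cscale rinner_cline z1 zv0 mulr0 addr0 mulr1.
have s_le1 : s <= 1 by nra.
have s2_le : s ^+ 2 <= s by rewrite expr2 ger_pMr.
have s2X_le : s ^+ 2 * X <= X by rewrite ler_piMl // (le_trans s2_le).
lra.
Qed.

(* Competitors are the normalised points of the line [z + t v]; homogeneity clears
   the normalisation factor. *)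
Lemma local_min_homogeneous f m z :
    (forall t w, f (cscale t w) = t ^+ (2 * m) * f w) -> local_min_sphere f z ->
  exists2 e, 0 < e & forall v t, rinner z v = 0 -> t ^+ 2 * norm2sq v < e ->
    f z * norm2sq (cline z v t) ^+ m <= f (cline z v t).
Proof.
move=> f_homo [z1 [eps eps_gt0 zmin]].
exists (eps ^+ 2 / 2) => [|v t zv0 t_small]; first by rewrite divr_gt0 ?exprn_gt0.
have [s [sE sw1 sw_near]] := sphere_retraction t z1 zv0.
have -> : f (cline z v t) =
    f (cscale s (cline z v t)) * norm2sq (cline z v t) ^+ m.
  by rewrite f_homo mulrAC exprM -exprMn sE expr1n mul1r.
apply: ler_wpM2r; first by rewrite exprn_ge0 ?norm2sq_ge0.
by apply: zmin => //; lra.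
Qed.

End SphereMinima.

Section FlatVectors.
Variables (R : realType) (n : nat).
Implicit Types (a v w z : 'I_n -> R[i]) (S : {set 'I_n}) (j k l : 'I_n) (c : R).

Definition flat_on S z :=
  S != set0 /\ forall k, cabs2 (z k) = (k \in S)%:R / #|S|%:R.

Lemma flat_on_notin S z k : flat_on S z -> k \notin S -> z k = 0.
Proof.
by move=> [_ zE] kNS; apply/eqP; rewrite -cabs2_eq0 zE (negPf kNS) mul0r.
Qed.

Lemma flat_on_sphere S z : flat_on S z -> on_sphere z.
Proof.
move=> [S_neq0 zE]; rewrite /on_sphere /norm2sq (eq_bigr _ (fun k _ => zE k)).
have sum_in : \sum_(k < n) (k \in S)%:R = #|S|%:R :> R.
  by rewrite -sum1_card natr_sum [RHS]big_mkcond; apply: eq_bigr => k _; case: ifP.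
by rewrite -mulr_suml sum_in divff // gt_eqF ?natr_card_gt0.
Qed.

Lemma norm4pow4_flat S z : flat_on S z -> norm4pow4 z = #|S|%:R^-1.
Proof.
move=> zf; rewrite -[RHS]mulr1 -[X in _ * X](flat_on_sphere zf) mulr_sumr.
apply: eq_bigr => k _; rewrite zf.2.
by case: (k \in S); rewrite ?mul1r ?mul0r ?mulr0 ?expr0n // expr2.
Qed.

Lemma flat_on_exists S : S != set0 -> exists z, flat_on S z.
Proof.
move=> S_neq0; exists (fun k => (Num.sqrt ((k \in S)%:R / #|S|%:R))%:C).
by split=> // k; rewrite cabs2_real sqr_sqrtr // divr_ge0.
Qed.

Lemma norm4pow4_ge S w : S != set0 -> on_sphere w ->
  (1 - 2 * mass_off S w) / #|S|%:R + \sum_(k | k \notin S) cabs2 (w k) ^+ 2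
    <= norm4pow4 w.
Proof.
move=> S_neq0 w1; rewrite /norm4pow4 [leRHS](bigID [in S]) /= lerD2r.
apply: le_trans (sum_sqr_ge_tangent S (fun k => cabs2 (w k)) #|S|%:R^-1).
have -> : \sum_(k in S) cabs2 (w k) = 1 - mass_off S w.
  by rewrite -w1 (norm2sq_mass_off S w) addrK.
have S_neq0r : #|S|%:R != 0 :> R by rewrite gt_eqF ?natr_card_gt0.
by rewrite le_eqVlt; apply/orP; left; apply/eqP; field.
Qed.

Definition coercive_off c S a := forall w, c * mass_off S w <= cabs2 (cinner a w).

Lemma coercive_off_le_cabs2 c S a j :
  coercive_off c S a -> j \notin S -> c <= cabs2 (a j).
Proof.
move=> coer jNS; have := coer (point_mass j 1).
rewrite mass_off_point_mass // cinner_point_mass cabs2M cabs2_conj cabs2_real.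
by rewrite expr1n !mulr1.
Qed.

Lemma coercive_off_notin_unique c S a j l :
  0 < c -> coercive_off c S a -> j \notin S -> l != j -> l \in S /\ a l = 0.
Proof.
move=> c_gt0 coer jNS lNj.
have aj_neq0 : a j != 0.
  by rewrite -cabs2_eq0 gt_eqF // (lt_le_trans c_gt0) // (coercive_off_le_cabs2 coer).
have mass_le0 : mass_off S (balanced_pair a j l 1) <= 0.
  rewrite -(pmulr_rle0 _ c_gt0); apply: le_trans (coer _) _.
  by rewrite cinner_balanced_pair // cabs20.
split; last first.
  apply/eqP; rewrite -(balanced_pair_eq0 lNj aj_neq0 (oner_neq0 _)).
  by rewrite (mass_off_le0 mass_le0).
apply: contraT => /(mass_off_le0 mass_le0)/eqP.
by rewrite balanced_pairE // eqxx oner_eq0.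
Qed.

Lemma coercive_offP c S a : 0 < c ->
  coercive_off c S a <->
  S = setT \/ exists j, [/\ S = [set~ j], csupp a = [set j] & c <= norm2sq a].
Proof.
have norm2sq_supp1 j : csupp a = [set j] -> norm2sq a = cabs2 (a j).
  by rewrite norm2sq_csupp => ->; rewrite big_set1.
move=> c_gt0; split=> [coer|[->|[j [-> aj c_le]]] w].
- have [->|/setTPn[j jNS]] := eqVneq S setT; [by left | right; exists j].
  have offj l : l != j -> l \in S /\ a l = 0.
    exact: coercive_off_notin_unique coer jNS.
  have c_le := coercive_off_le_cabs2 coer jNS.
  have aj : csupp a = [set j].
    apply/setP => k; rewrite !inE; have [->|/offj[_ ->]] := eqVneq k j.
      by rewrite -cabs2_eq0 gt_eqF // (lt_le_trans c_gt0).
    by rewrite eqxx.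
  split=> //; last by rewrite (norm2sq_supp1 j).
  apply/setP => k; rewrite !inE; have [->|/offj[->]] := eqVneq k j; last by [].
  exact: negPf.
- by rewrite mass_off_setT mulr0 cabs2_ge0.
rewrite (norm2sq_supp1 j aj) in c_le.
rewrite mass_off_setC1 cinner_csupp aj big_set1 cabs2M cabs2_conj.
by rewrite ler_wpM2r ?cabs2_ge0.
Qed.

Definition stability_const (beta : R) S : R := 2 * beta / #|S|%:R.

Lemma stability_const_gt0 (beta : R) S :
  0 < beta -> S != set0 -> 0 < stability_const beta S.
Proof. by move=> beta_gt0 S_neq0; rewrite divr_gt0 ?mulr_gt0 ?natr_card_gt0. Qed.

End FlatVectors.

Section LocalMinima.
Variables (R : realType) (n : nat) (a : 'I_n -> R[i]) (beta : R).
Hypothesis beta_gt0 : 0 < beta.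
Implicit Types (v w z : 'I_n -> R[i]) (S : {set 'I_n}) (j k l : 'I_n).

Definition fobj_homog w : R :=
  2^-1 * cabs2 (cinner a w) * norm2sq w + beta / 2 * norm4pow4 w.

Lemma fobj_homog_cscale (t : R) w :
  fobj_homog (cscale t w) = t ^+ (2 * 2) * fobj_homog w.
Proof.
rewrite /fobj_homog cinner_cscale cabs2M cabs2_real norm2sq_cscale norm4pow4_cscale.
by ring.
Qed.

Lemma fobj_homog_sphere w : on_sphere w -> fobj_homog w = fobj a beta w.
Proof. by rewrite /fobj_homog => ->; rewrite mulr1. Qed.

Lemma fobj_orthogonal z : cinner a z = 0 -> fobj a beta z = beta / 2 * norm4pow4 z.
Proof. by move=> az0; rewrite /fobj az0 cabs20 mulr0 add0r. Qed.

Lemma fobj_homog_min z : local_min_sphere (fobj a beta) z ->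
  local_min_sphere fobj_homog z.
Proof.
move=> [z1 [eps eps_gt0 zmin]]; split=> //; exists eps => // w w1 wz.
by rewrite !fobj_homog_sphere ?zmin.
Qed.

Lemma local_min_variation z v :
    local_min_sphere (fobj a beta) z -> cinner a z = 0 -> rinner z v = 0 ->
  \sum_(k < n) cabs2 (z k) * rdot (z k) (v k) = 0 /\
  0 <= cabs2 (cinner a v) +
       beta * (\sum_(k < n) (4 * rdot (z k) (v k) ^+ 2
                             + 2 * cabs2 (z k) * cabs2 (v k))
               - 2 * norm4pow4 z * norm2sq v).
Proof.
move=> zmin az0 zv0.
set first_sum := \sum_(k < n) _ * _; set second_sum := \sum_(k < n) (_ + _).
set av2 := cabs2 _; set z4 := norm4pow4 z; set v2 := norm2sq v.
have [e e_gt0 homog_min] :=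
  local_min_homogeneous fobj_homog_cscale (fobj_homog_min zmin).
pose third_sum := \sum_(k < n) rdot (z k) (v k) * cabs2 (v k).
pose p := Poly [:: 0; 2 * beta * first_sum;
  2^-1 * av2 + beta / 2 * (second_sum - 2 * z4 * v2); 2 * beta * third_sum;
  2^-1 * av2 * v2 + beta / 2 * (norm4pow4 v - z4 * v2 ^+ 2)].
have pE t : p.[t] =
    fobj_homog (cline z v t) - fobj_homog z * norm2sq (cline z v t) ^+ 2.
  rewrite horner_Poly /= (fobj_homog_sphere zmin.1) fobj_orthogonal //.
  rewrite /fobj_homog cinner_cline az0 add0r cabs2M cabs2_real norm4pow4_cline.
  rewrite norm2sq_cline zmin.1 zv0 -/av2 -/z4 -/first_sum -/second_sum -/third_sum -/v2.
  by field.
have [d d_gt0 small] := sqrM_lt_near0 v2 e_gt0.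
have [|p1_eq0 p2_ge0] := poly_local_min0 (p := p) d_gt0.
  move=> t t_lt; rewrite horner_coef0 coef_Poly pE subr_ge0.
  by apply: homog_min => //; apply: small.
move: p1_eq0 p2_ge0; rewrite !coef_Poly /= => first_eq0 second_ge0.
split; last lra.
by move/eqP: first_eq0; rewrite !mulf_eq0 pnatr_eq0 (gt_eqF beta_gt0) => /eqP.
Qed.

Lemma local_min_modulus z k :
    local_min_sphere (fobj a beta) z -> cinner a z = 0 -> z k != 0 ->
  cabs2 (z k) = norm4pow4 z.
Proof.
move=> zmin az0 zk_neq0.
pose v l := ((l == k)%:R - cabs2 (z k))%:C * z l.
have sum_rdot (x : 'I_n -> R) : \sum_(l < n) x l * rdot (z l) (v l) =
    x k * cabs2 (z k) - cabs2 (z k) * \sum_(l < n) x l * cabs2 (z l).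
  have -> : x k * cabs2 (z k) = \sum_(l < n | l == k) x l * cabs2 (z l).
    by rewrite big_pred1_eq.
  rewrite [X in X - _]big_mkcond mulr_sumr -sumrB; apply: eq_bigr => l _.
  by rewrite rdotZr rdotcc; case: (l == k) => /=; ring.
have zv0 : rinner z v = 0.
  have := sum_rdot (fun=> 1); under eq_bigr do rewrite mul1r.
  rewrite -/(rinner z v) => ->; under eq_bigr do rewrite mul1r.
  by rewrite -/(norm2sq z) zmin.1 mul1r mulr1 subrr.
have [] := local_min_variation zmin az0 zv0; rewrite sum_rdot => + _.
move/eqP; rewrite -mulrBr mulf_eq0 cabs2_eq0 (negPf zk_neq0) subr_eq0 => /eqP ->.
by apply: eq_bigr => l _; rewrite expr2.
Qed.

Lemma local_min_flat z :
  local_min_sphere (fobj a beta) z -> cinner a z = 0 -> flat_on (csupp z) z.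
Proof.
move=> zmin az0.
have zE k : cabs2 (z k) = (k \in csupp z)%:R * norm4pow4 z.
  have [|/csuppPn ->] := boolP (k \in csupp z); last by rewrite cabs20 mul0r.
  by rewrite inE mul1r; apply: local_min_modulus.
have cardE : #|csupp z|%:R * norm4pow4 z = 1.
  rewrite -[RHS]zmin.1 norm2sq_csupp -sum1_card natr_sum mulr_suml.
  by apply: eq_bigr => k k_supp; rewrite zE k_supp.
have supp_neq0 : csupp z != set0.
  by apply: contra_eq_neq cardE => ->; rewrite cards0 mul0r eq_sym oner_eq0.
split=> // k; rewrite zE; congr (_ * _).
have card_neq0 : #|csupp z|%:R != 0 :> R by rewrite gt_eqF ?natr_card_gt0.
by apply: (mulfI card_neq0); rewrite cardE divff.
Qed.

Lemma local_min_second_order S z v :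
    local_min_sphere (fobj a beta) z -> cinner a z = 0 -> flat_on S z ->
    (forall k, rdot (z k) (v k) = 0) ->
  stability_const beta S * mass_off S v <= cabs2 (cinner a v).
Proof.
move=> zmin az0 zf rot.
have zv0 : rinner z v = 0 by rewrite /rinner big1.
have [_] := local_min_variation zmin az0 zv0.
have -> : \sum_(k < n) (4 * rdot (z k) (v k) ^+ 2 + 2 * cabs2 (z k) * cabs2 (v k)) =
    2 / #|S|%:R * \sum_(k in S) cabs2 (v k).
  rewrite [\sum_(k in S) _]big_mkcond mulr_sumr; apply: eq_bigr => k _.
  by rewrite rot zf.2; case: (k \in S) => /=; ring.
rewrite (norm4pow4_flat zf) (norm2sq_mass_off S v) /stability_const; lra.
Qed.

(* Rotating the phase of [z l] costs nothing to second order; compensating it in a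
   coordinate [j] where [z] vanishes would strictly decrease the objective if
   [a l] were nonzero. *)
Lemma local_min_coef_eq0 S z j l :
    local_min_sphere (fobj a beta) z -> cinner a z = 0 -> flat_on S z ->
    j \notin S -> l \in S -> a l = 0.
Proof.
move=> zmin az0 zf jNS lS.
have c_gt0 := stability_const_gt0 beta_gt0 zf.1.
have second_order := local_min_second_order zmin az0 zf.
have zj0 := flat_on_notin zf jNS.
have lNj : l != j by apply: contraTneq lS => ->.
have aj_neq0 : a j != 0.
  have := second_order (point_mass j 1).
  rewrite mass_off_point_mass // cinner_point_mass cabs2M cabs2_conj cabs2_real.
  rewrite expr1n !mulr1 -cabs2_eq0 => c_le; rewrite gt_eqF // (lt_le_trans c_gt0) //.
  by apply: c_le => k; rewrite /point_mass; case: eqP => [->|_];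
    rewrite ?zj0 ?rdot0l ?rdot0r.
have x_neq0 : 'i * z l != 0.
  rewrite mulf_neq0 ?neq0Ci // -cabs2_eq0 zf.2 lS mul1r.
  by rewrite invr_eq0 gt_eqF ?natr_card_gt0 ?zf.1.
have mass_le0 : mass_off S (balanced_pair a j l ('i * z l)) <= 0.
  rewrite -(pmulr_rle0 _ c_gt0); apply: le_trans (second_order _ _) _ => [k|].
    rewrite balanced_pairE //; case: eqP => [->|_]; first exact: rdot_mulir.
    by case: eqP => [->|_]; rewrite ?zj0 ?rdot0l ?rdot0r.
  by rewrite cinner_balanced_pair // cabs20.
by apply/eqP; rewrite -(balanced_pair_eq0 lNj aj_neq0 x_neq0) (mass_off_le0 mass_le0).
Qed.

Lemma local_min_coercive S z :
    local_min_sphere (fobj a beta) z -> cinner a z = 0 -> flat_on S z ->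
  coercive_off (stability_const beta S) S a.
Proof.
move=> zmin az0 zf w.
have [->|/setTPn[j jNS]] := eqVneq S setT.
  by rewrite mass_off_setT mulr0 cabs2_ge0.
pose v k := if k \in S then 0 else w k.
have -> : mass_off S w = mass_off S v.
  by apply: eq_bigr => k /negPf kNS; rewrite /v kNS.
have -> : cinner a w = cinner a v.
  apply: eq_bigr => k _; rewrite /v; case: ifP => // kS.
  by rewrite (local_min_coef_eq0 zmin az0 zf jNS kS) rmorph0 !mul0r.
apply: (local_min_second_order zmin az0 zf) => k; rewrite /v.
by case: ifPn => [_|/(flat_on_notin zf) ->]; rewrite ?rdot0l ?rdot0r.
Qed.

End LocalMinima.

Section OptimalityCertificates.
Variables (R : realType) (n : nat) (a : 'I_n -> R[i]) (beta : R).
Hypothesis beta_gt0 : 0 < beta.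
Implicit Types (w y z : 'I_n -> R[i]) (S : {set 'I_n}).

Definition optimality_certificate S z :=
  [/\ flat_on S z, cinner a z = 0 & coercive_off (stability_const beta S) S a].

Lemma fobj_certificate S z :
  optimality_certificate S z -> fobj a beta z = beta / 2 / #|S|%:R.
Proof. by move=> [zf az0 _]; rewrite fobj_orthogonal // (norm4pow4_flat zf). Qed.

Lemma fobj_ge S w :
    S != set0 -> coercive_off (stability_const beta S) S a -> on_sphere w ->
  beta / 2 / #|S|%:R + beta / 2 * \sum_(k | k \notin S) cabs2 (w k) ^+ 2
    <= fobj a beta w.
Proof.
move=> S_neq0 coer w1; have := coer w; have := norm4pow4_ge S_neq0 w1.
rewrite -(ler_pM2l beta_gt0) /fobj /stability_const; lra.
Qed.

Lemma certificate_global_min S z :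
  optimality_certificate S z -> global_min_sphere (fobj a beta) z.
Proof.
move=> cert; have [zf _ coer] := cert; split=> [|w w1]; first exact: flat_on_sphere zf.
rewrite (fobj_certificate cert); apply: le_trans (fobj_ge zf.1 coer w1).
by rewrite lerDl mulr_ge0 ?divr_ge0 ?(ltW beta_gt0) ?sumr_ge0 // => k _; apply: sqr_ge0.
Qed.

Lemma local_min_certificateP z :
  local_min_sphere (fobj a beta) z /\ cinner a z = 0 <->
  exists S, optimality_certificate S z.
Proof.
split=> [[zmin az0]|[S cert]].
  exists (csupp z); have zf := local_min_flat beta_gt0 zmin az0.
  by split=> //; apply: local_min_coercive zmin az0 zf.
split; first exact: global_local_min (certificate_global_min cert).
by case: cert.
Qed.

Lemma global_min_orthogonal S y z :
    optimality_certificate S y -> global_min_sphere (fobj a beta) z ->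
  cinner a z = 0.
Proof.
move=> cert [z1 zmin]; have [yf _ coer] := cert.
have fz_le := zmin _ (flat_on_sphere yf); rewrite (fobj_certificate cert) in fz_le.
have z_off k : k \notin S -> cabs2 (z k) = 0.
  have sum_le0 : \sum_(k | k \notin S) cabs2 (z k) ^+ 2 <= 0.
    have := le_trans (fobj_ge yf.1 coer z1) fz_le.
    by rewrite gerDl pmulr_rle0 ?divr_gt0.
  move=> kNS; apply/eqP; rewrite -sqrf_eq0; apply/eqP; move: k kNS.
  apply/psumr_eq0P => [k _|]; first exact: sqr_ge0.
  by apply/eqP; rewrite eq_le sum_le0 sumr_ge0 // => k _; apply: sqr_ge0.
have := norm4pow4_ge yf.1 z1; rewrite /mass_off big1 //.
rewrite big1 => [|k /z_off ->]; last by rewrite expr0n.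
rewrite mulr0 subr0 addr0 mul1r => norm4_ge; apply/eqP; rewrite -cabs2_le0.
have := ler_wpM2l (ltW beta_gt0) norm4_ge; move: fz_le; rewrite /fobj; lra.
Qed.

End OptimalityCertificates.

Section CertificateExistence.
Variables (R : realType) (n : nat) (a : 'I_n -> R[i]).
Implicit Types (z : 'I_n -> R[i]) (S : {set 'I_n}) (j k : 'I_n).

Lemma norm_conjM_flat_setT z k : flat_on setT z ->
  `|(a k)^* * z k| = (Num.sqrt n%:R^-1 * cabs (a k))%:C.
Proof.
move=> [_ zE]; rewrite normrM norm_conjC rmorphM /= cabsE mulrC; congr (_ * _).
by rewrite -cabsE /cabs zE inE mul1r cardsT card_ord.
Qed.

Lemma polygon_inequalityP :
  norminf a <= 2^-1 * norm1 a <-> forall k, 2 * cabs (a k) <= norm1 a.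
Proof.
have half x : (x <= 2^-1 * norm1 a) = (2 * x <= norm1 a).
  by rewrite mulrC ler_pdivlMr // mulrC.
split=> [norminf_le k|a_le].
  by rewrite -half; apply: le_trans norminf_le; apply: le_bigmax.
apply: bigmax_le => [|k _]; last by rewrite half.
by rewrite mulr_ge0 ?invr_ge0 ?sumr_ge0 // => k _; apply: cabs_ge0.
Qed.

Lemma flat_setT_orthogonalP : (0 < n)%N ->
  (exists2 z, flat_on setT z & cinner a z = 0) <-> norminf a <= 2^-1 * norm1 a.
Proof.
move=> n_gt0; pose radius : R := Num.sqrt n%:R^-1.
have radius_gt0 : 0 < radius by rewrite sqrtr_gt0 invr_gt0 ltr0n.
rewrite polygon_inequalityP; split=> [[z zf az0] k|a_le].
  have := ler_norm_sum_eq0 k az0; rewrite norm_conjM_flat_setT //.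
  under eq_bigr do rewrite norm_conjM_flat_setT //.
  rewrite -!rmorph_sum -mulr_sumr -(rmorph_nat (real_complex R)) -rmorphM lecR.
  by rewrite mulrCA ler_pM2l.
have [|||||u normu uE] := @polygon_exists R _ (index_enum 'I_n) (fun k => cabs (a k)) 0.
- exact: index_enum_uniq.
- by move=> k; apply: cabs_ge0.
- by [].
- by apply: sumr_ge0 => k _; apply: cabs_ge0.
- by move=> k _; rewrite add0r; apply: a_le.
have /fin_all_exists2[p normp aE] k := polar_form (a k).
exists (cscale radius (fun k => p k * u k)).
  split=> [|k]; first by apply/set0Pn; exists (Ordinal n_gt0); rewrite inE.
  apply: complexI; rewrite cabs2E !normrM normp normu !mulr1 -cabs2E cabs2_real.
  by rewrite sqr_sqrtr ?invr_ge0 // inE cardsT card_ord mul1r.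
rewrite cinner_cscale.
suff -> : cinner a (fun k => p k * u k) = 0%:C by rewrite mulr0.
rewrite -uE; apply: eq_bigr => k _; rewrite mulrA; congr (_ * _).
rewrite [a k in LHS]aE rmorphM /= conj_normC -mulrA -normCKC normp.
by rewrite expr1n mulr1 cabsE.
Qed.

Lemma certificate_existsP (beta : R) : (2 <= n)%N -> 0 < beta ->
  (exists z S, optimality_certificate a beta S z) <->
  norminf a <= 2^-1 * norm1 a \/
  (#|csupp a| = 1%N /\ norm2sq a >= 2 * beta / (n%:R - 1)).
Proof.
move=> n_ge2 beta_gt0; have n_gt0 := ltnW n_ge2.
have coerP S (S_neq0 : S != set0) :=
  coercive_offP S a (stability_const_gt0 beta_gt0 S_neq0).
have constC1 j : stability_const beta [set~ j] = 2 * beta / (n%:R - 1).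
  by rewrite /stability_const cardsC1 card_ord -subn1 natrB.
split=> [[z [S [zf az0 coer]]]|].
  have [ST|[j [Sj aj a_ge]]] := (coerP S zf.1).1 coer.
    by left; apply/flat_setT_orthogonalP => //; exists z; rewrite -?ST.
  by right; rewrite aj cards1 -(constC1 j) -Sj.
case=> [/(flat_setT_orthogonalP n_gt0)[z zf az0]|[/eqP/cards1P[j aj] a_ge]].
  by exists z, setT; split=> //; apply/(coerP _ zf.1); left.
have C1_neq0 : [set~ j] != set0 by rewrite -card_gt0 cardsC1 card_ord -subn1 subn_gt0.
have [z zf] := flat_on_exists R C1_neq0; exists z, [set~ j]; split=> //.
  by rewrite cinner_csupp aj big_set1 (flat_on_notin zf) ?mulr0 // !inE eqxx.
by apply/(coerP _ C1_neq0); right; exists j; rewrite constC1.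
Qed.

End CertificateExistence.

Theorem theorem9 (R : realType) (n : nat) (a : 'I_n -> R[i]) (beta : R) :
  (2 <= n)%N -> 0 < beta ->
  let f := fobj a beta in
  let cond := norminf a <= 2^-1 * norm1 a \/
              (#|[set k | a k != 0]| = 1%N /\
               norm2sq a >= 2 * beta / (n%:R - 1)) in
  ((exists z, local_min_sphere f z /\ cinner a z = 0) <-> cond) /\
  (cond -> forall z, (local_min_sphere f z /\ cinner a z = 0) <->
                     global_min_sphere f z).
Proof.
move=> n_ge2 beta_gt0 f cond.
have certP z := local_min_certificateP a beta_gt0 z.
have condP : (exists z S, optimality_certificate a beta S z) <-> cond :=
  certificate_existsP a n_ge2 beta_gt0.
split; first by rewrite -condP; split=> -[z /certP cert]; exists z.
move=> /condP[y [S cert_y]] z; split=> [/certP[T cert_z]|zmin].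
  exact: certificate_global_min cert_z.
by split; [exact: global_local_min | exact: global_min_orthogonal cert_y zmin].
Qed.
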